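(* Let $\beta(N)=(d_i(N))$ be the base phi representation of a natural number $N$, and let $\varphi=(1+\sqrt5)/2$. Then: (1) $d_0(N)=1$ if and only if $N=\lfloor n\varphi\rfloor+2n+1$ for some natural number $n$; (2) $d_1d_0(N)=10$ if and only if $N=\lfloor n\varphi\rfloor+2n-1$ for some natural number $n$; (3) $d_1d_0d_{-1}(N)=000$ if and only if $N=\lfloor n\varphi\rfloor+2n$ for some natural number $n$; (4) $d_1d_0d_{-1}(N)=001$ if and only if $N=3\lfloor n\varphi\rfloor+n+1$ for some natural number $n$.
   Context: Let $\varphi=(1+\sqrt5)/2$ be the golden mean. Every natural number $N$ can be written in exactly one way as $N=\sum_{i=-\infty}^{\infty}d_i\varphi^i$ with digits $d_i\in\{0,1\}$, only finitely many of them nonzero, where $d_id_{i+1}=11$ (two consecutive digits both equal to 1) is not allowed. This is called the base phi representation of $N$; its digits are denoted $d_i(N)$, and one writes $\beta(N)=d_Ld_{L-1}\dots d_1d_0\cdot d_{-1}d_{-2}\dots d_{R-1}d_R$, or $\beta(N)=(d_i(N))$. Expressions such as $d_1d_0(N)=10$ and $d_1d_0d_{-1}(N)=001$ denote strings of digits, not products: the former means $d_1(N)=1$ and $d_0(N)=0$, the latter means $d_1(N)=0$, $d_0(N)=0$ and $d_{-1}(N)=1$. Here $\lfloor\cdot\rfloor$ denotes the floor function.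
   Formalization: In (4) the natural number n is required to be at least 1, because n = 0 gives N = 1, whose digits d_1d_0d_{-1} are 010 and not 001; in (1)–(3) n = 0 is allowed, as (1) at N = 1 requires. *)

(* Defs.v *)
From mathcomp Require Import all_boot all_order all_algebra.
From mathcomp Require Import all_classical all_reals.

Set Implicit Arguments.
Unset Strict Implicit.
Unset Printing Implicit Defensive.

Import Order.TTheory GRing.Theory Num.Theory.
Local Open Scope classical_set_scope.
Local Open Scope ring_scope.

Definition golden_mean (R : realType) : R := (1 + Num.sqrt 5) / 2.

(* The sum over a set is 0 by convention when the support of the summand is    *)
(* infinite, so the third clause is what makes the last one meaningful.        *)
Definition base_phi_representation (R : realType) (N : nat) (d : int -> nat)
    : Prop :=
  [/\ forall i : int, d i = 0%N \/ d i = 1%N,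
      forall i : int, ~ (d i = 1%N /\ d (i + 1) = 1%N),
      finite_set [set i : int | d i != 0%N] &
      N%:R = \sum_(i \in [set: int]) (d i)%:R * golden_mean R ^ i :> R].

(* Main.v *)
Require Import Defs.
From mathcomp Require Import all_boot all_order all_algebra.
From mathcomp Require Import all_classical all_reals.
From mathcomp Require Import zify ring lra.
Import Order.TTheory GRing.Theory Num.Theory.
Local Open Scope ring_scope.

(** Cut the expansion of [N] at the radix point, [N = A + B], where
    [A = a + b phi] collects the digits of index [>= 0] and [B] the others.
    Two real numbers are then confined to intervals that depend only on
    the digits [d_1, d_0, d_(-1)]:
    - the conjugate [A' = a + b psi], with [psi = 1 - phi = - 1/phi], because it
      is the sum of [d_i psi ^ i] and admissible sums of powers of [psi] lie in
      [(-1, phi)] ([digit_sum_conj_bound] and the refinements after it);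
    - the tail [B], because admissible sums of negative powers of [phi] lie in
      [[0, 1)] ([fractional_part_bound]).
    In each of the four cases the bounds on [B - A' = N - 2 a - b] isolate one
    integer, which gives [N] as a function of [a] and [b]; what remains of the
    bounds is an inequality on [a] and [b] that says that one of them,
    up to a constant, is [floor (n phi)] for an [n] built from the other.  This
    is the implication from digits to formulas ([base_phi_classify]).

    For the converses, the four digit patterns exhaust all possibilities, so
    it suffices that no number is given by two of the four formulas.  Put
    [s n = floor (n phi) + 2 n].  Its steps are at least 3, so that the values of
    [s - 1], [s] and [s + 1] never collide ([beatty_shift_inj]).  The identity
    [floor (floor (n phi) phi) = floor (n phi) + n - 1] for [n > 0], which rests
    on the irrationality of [phi], shows that a number of the fourth kind is
    both [s k + 2] and [s (k + 1) - 2] for [k = floor (n phi)], hence lies in a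
    gap between the other three ([beatty_rest_gap], [beatty_shift_rest]). *)

(** * Arithmetic of the golden mean *)

Section GoldenMean.
Variable R : realType.
Notation phi := (golden_mean R).
Notation psi := (1 - golden_mean R).

Lemma golden_mean_sqr : phi ^+ 2 = phi + 1.
Proof.
rewrite /golden_mean; have : Num.sqrt (5 : R) ^+ 2 = 5 by rewrite sqr_sqrtr.
by move: (Num.sqrt 5) => s hs; field: hs.
Qed.

Lemma golden_mean_gt1 : 1 < phi.
Proof.
rewrite /golden_mean; have : Num.sqrt (5 : R) ^+ 2 = 5 by rewrite sqr_sqrtr.
have := sqrtr_ge0 (5 : R); move: (Num.sqrt 5) => s s0 hs; nra.
Qed.

Lemma golden_mean_lt2 : phi < 2.
Proof. have := golden_mean_sqr; have := golden_mean_gt1; nra. Qed.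

Lemma golden_mean_neq0 : phi != 0.
Proof. by apply: lt0r_neq0; have := golden_mean_gt1; lra. Qed.

Lemma golden_meanV : phi^-1 = phi - 1.
Proof.
apply: (mulfI golden_mean_neq0); rewrite mulfV ?golden_mean_neq0//.
by have := golden_mean_sqr; lra.
Qed.

(** A relation [n phi = k] yields [(2 k - n) ^ 2 = 5 n ^ 2], where the exponents
    of the prime 5 on both sides have different parities unless [n = 0]. *)
Lemma golden_mean_irrational (n k : int) : n%:~R * phi = k%:~R -> n = 0.
Proof.
move=> hnk.
have h5 : (2 * k - n) ^+ 2 = 5 * n ^+ 2.
  apply/eqP; rewrite -(eqr_int R) !(rmorphXn, rmorphM, rmorphB) /= -hnk.
  by apply/eqP; ring: golden_mean_sqr.
have {}h5 : (absz (2 * k - n)%R ^ 2 = 5 * absz n ^ 2)%N by rewrite -!abszX h5 abszM.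
apply/eqP/negPn/negP => n0.
have n_gt0 : (0 < absz n)%N by rewrite absz_gt0.
have := congr1 (fun m => odd (logn 5 m)) h5.
by rewrite lognM ?expn_gt0 ?n_gt0 // !lognX !mul2n (@logn_prime 5 5) // oddD !odd_double.
Qed.

(** * Admissible digit sums and their bounds *)

Definition digit_sum (x : R) (e : nat -> nat) (K : nat) : R :=
  \sum_(i < K) (e i)%:R * x ^+ i.

Lemma digit_sumS x e K :
  digit_sum x e K.+1 = (e 0)%:R + x * digit_sum x (fun i => e i.+1) K.
Proof.
rewrite /digit_sum big_ord_recl expr0 mulr1 mulr_sumr; congr (_ + _).
by apply: eq_bigr => i _; rewrite exprS mulrCA.
Qed.

Definition phi_digits (e : nat -> nat) :=
  (forall i, e i = 0 \/ e i = 1)%N /\ (forall i, e i = 1 -> e i.+1 = 0)%N.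

Lemma phi_digits_shift e : phi_digits e -> phi_digits (fun i => e i.+1).
Proof. by case=> h1 h2; split=> i; [apply: h1 | apply: h2]. Qed.

(** [Z[phi]] is a ring on which conjugation is well defined at the level of the
    coefficients [a] and [b]; exhibiting both evaluations with the same
    coefficients avoids choosing them by irrationality. *)
Lemma digit_sum_conj e K : exists a b : int,
  digit_sum phi e K = a%:~R + b%:~R * phi /\
  digit_sum psi e K = a%:~R + b%:~R * psi.
Proof.
elim: K e => [|K IH] e.
  by exists 0, 0; rewrite /digit_sum !big_ord0; split; ring.
have [a [b [hA hA']]] := IH (fun i => e i.+1).
exists ((e 0)%:Z + b), (a + b); rewrite !digit_sumS hA hA'.
have h := golden_mean_sqr; split; ring: h.
Qed.

(** The bound is the geometric sum [1 + phi^-2 + phi^-4 + ... = phi].  The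
    sharper bound when the leading digit is 0 is what makes the induction go
    through: a leading 1 is followed by a 0. *)
Lemma digit_sum_inv_bound e K : phi_digits e ->
  0 <= digit_sum phi^-1 e K < phi /\
  (e 0%N = 0%N -> digit_sum phi^-1 e K < 1).
Proof.
have g1 := golden_mean_gt1; have g2 := golden_mean_lt2; have g := golden_mean_sqr.
rewrite golden_meanV.
elim: K e => [|K IH] e he; first by rewrite /digit_sum big_ord0; split; lra.
have [/andP[lo hi] hi0] := IH _ (phi_digits_shift _ he).
rewrite digit_sumS; have [[h|h] h1] := (he.1 0%N, he.2 0%N); rewrite h.
  by split; [apply/andP; split|]; nra.
by move/hi0: (h1 h) => hi1; split=> //; apply/andP; split; nra.
Qed.

(** The extreme values come from taking all even or all odd positions:
    [1 + psi^2 + psi^4 + ... = phi] and [psi + psi^3 + ... = -1]. As in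
    [digit_sum_inv_bound], the second part carries the induction over a leading
    digit 1. *)
Lemma digit_sum_conj_bound e K : phi_digits e ->
  -1 < digit_sum psi e K < phi /\
  (e 0%N = 0%N -> digit_sum psi e K < phi - 1).
Proof.
have g1 := golden_mean_gt1; have g2 := golden_mean_lt2; have g := golden_mean_sqr.
elim: K e => [|K IH] e he; first by rewrite /digit_sum big_ord0; split; lra.
have [/andP[lo hi] hi0] := IH _ (phi_digits_shift _ he).
rewrite digit_sumS; have [[h|h] h1] := (he.1 0%N, he.2 0%N); rewrite h.
  by split; [apply/andP; split|]; nra.
by move/hi0: (h1 h) => hi1; split=> //; apply/andP; split; nra.
Qed.

(** [Negz i] is [- i - 1]: the digits after the radix point, read from left to
    right, are [d (Negz 0), d (Negz 1), ...].  The common length is taken at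
    least 2 so that the two lowest digits can be peeled off. *)
Lemma base_phi_split N d : base_phi_representation R N d ->
  exists K : nat, N%:R = digit_sum phi (fun i => d (Posz i)) K.+2
    + phi^-1 * digit_sum phi^-1 (fun i => d (Negz i)) K.+2.
Proof.
case=> _ _ /finite_seqP[s hs] ->.
pose K := \max_(i <- s) (absz i).
have hK i : d i != 0%N -> (absz i <= K)%N.
  move=> di; have : i \in s by have : [set` s]%classic i by rewrite -hs.
  by move=> si; apply: (@leq_bigmax_seq _ s xpredT (fun i : int => absz i)).
exists K.
pose r := [seq Posz i | i <- iota 0 K.+2] ++ [seq Negz i | i <- iota 0 K.+2].
rewrite (@fsbigE _ _ _ _ _ r) //; last first.
- move=> i _ ir; case: (eqVneq (d i) 0%N) => [->|/hK hi]; first by rewrite mul0r.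
  case/negP: ir; rewrite mem_cat; case: i hi => i hi; apply/orP; [left|right];
    by apply: map_f; rewrite mem_iota; lia.
- rewrite cat_uniq !map_inj_uniq ?iota_uniq //; try by move=> i j [].
  by rewrite andbT; apply/hasPn => _ /mapP[i _ ->]; apply/mapP => -[j].
rewrite (eq_bigl xpredT) => [|i]; last exact: in_setT.
rewrite big_cat !big_map -/(index_iota 0 K.+2) !big_mkord.
congr (_ + _); rewrite mulr_sumr; apply: eq_bigr => i _.
by rewrite -[phi ^ Negz i]/(phi ^- i.+1) -exprVn exprS; ring.
Qed.

(** The next three lemmas cut the window [(-1, phi)] of conjugates into pieces
    [(-1, phi - 2)], [(phi - 2, phi - 1)] and [(phi - 1, phi)], one for
    each value of the two lowest digits.  Each is obtained by peeling off one
    digit and applying to the rest a bound already known. *)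
Lemma digit_sum_conj_1 e K : phi_digits e -> e 0%N = 1%N ->
  phi - 1 < digit_sum psi e K.+1 < phi.
Proof.
have g1 := golden_mean_gt1; have g2 := golden_mean_lt2; have g := golden_mean_sqr.
move=> he h0; have [/andP[_ ->] _] := digit_sum_conj_bound e K.+1 he.
have [_ /(_ (he.2 _ h0))] := digit_sum_conj_bound _ K (phi_digits_shift _ he).
by rewrite (digit_sumS _ e) h0 andbT; nra.
Qed.

Lemma digit_sum_conj_01 e K : phi_digits e -> e 0%N = 0%N -> e 1%N = 1%N ->
  -1 < digit_sum psi e K.+2 < phi - 2.
Proof.
have g1 := golden_mean_gt1; have g2 := golden_mean_lt2; have g := golden_mean_sqr.
move=> he h0 h1; have [/andP[-> _] _] := digit_sum_conj_bound e K.+2 he.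
have /andP[] := digit_sum_conj_1 _ K (phi_digits_shift _ he) h1.
by rewrite (digit_sumS _ e) h0; nra.
Qed.

Lemma digit_sum_conj_00 e K : phi_digits e -> e 0%N = 0%N -> e 1%N = 0%N ->
  phi - 2 < digit_sum psi e K.+2 < phi - 1.
Proof.
have g1 := golden_mean_gt1; have g2 := golden_mean_lt2; have g := golden_mean_sqr.
move=> he h0 h1; have [_ /(_ h0) ->] := digit_sum_conj_bound e K.+2 he.
have [_ /(_ h1)] := digit_sum_conj_bound _ K.+1 (phi_digits_shift _ he).
by rewrite (digit_sumS _ e) h0 andbT; nra.
Qed.

Lemma fractional_part_bound K (e : nat -> nat) : phi_digits e ->
  let B := phi^-1 * digit_sum phi^-1 e K.+1 in
  [/\ 0 <= B < 1, e 0%N = 0%N -> B < phi - 1 & e 0%N = 1%N -> phi - 1 <= B].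
Proof.
have g1 := golden_mean_gt1; have g2 := golden_mean_lt2; have g := golden_mean_sqr.
move=> he /=; have [/andP[lo hi] hi0] := digit_sum_inv_bound e K.+1 he.
have [/andP[lo' _] _] := digit_sum_inv_bound _ K (phi_digits_shift _ he).
split.
- by rewrite golden_meanV in lo hi *; apply/andP; split; nra.
- by move/hi0; rewrite golden_meanV; nra.
- by move=> h; rewrite digit_sumS h golden_meanV in lo' *; nra.
Qed.

(** * The four integer sequences *)

Definition beatty_shift (c : int) (N : nat) :=
  exists n : nat, N%:Z = Num.floor (n%:R * phi) + 2 * n%:Z + c.

Definition beatty_rest (N : nat) :=
  exists n : nat, (0 < n)%N /\ N%:Z = 3 * Num.floor (n%:R * phi) + n%:Z + 1.

(** Since [phi > 1], each step increases [floor (n phi)] by at least 1. *)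
Lemma beatty_step_ge3 (m n : nat) : (m < n)%N ->
  Num.floor (m%:R * phi) + 2 * m%:Z + 3 <= Num.floor (n%:R * phi) + 2 * n%:Z.
Proof.
move=> lt_mn; suff : Num.floor (m%:R * phi) < Num.floor (n%:R * phi) by lia.
rewrite -(ltr_int R).
have := floor_itv (m%:R * phi); have := floor_itv (n%:R * phi).
have : m%:R + 1 <= n%:R :> R by rewrite natr1 ler_nat.
have := golden_mean_gt1; rewrite !intrD.
move=> ? ? /andP[? ?] /andP[? ?]; nra.
Qed.

(** Multiplying the hypothesis by [phi] turns it into [0 <= n phi - b < 1], that
    is, [b = floor (n phi)].  A negative [n] would force [b < 0] and [N < 0]. *)
Lemma beatty_shift_of_window (N : nat) (n b c : int) : c <= 1 ->
  0 <= n%:~R - b%:~R * (phi - 1) < phi - 1 -> N%:Z = b + 2 * n + c ->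
  beatty_shift c N.
Proof.
have g1 := golden_mean_gt1; have g2 := golden_mean_lt2; have g := golden_mean_sqr.
move=> c1 /andP[lo hi] hN.
have fl : b%:~R <= n%:~R * phi < (b + 1)%:~R.
  have e : phi * (n%:~R - b%:~R * (phi - 1)) = n%:~R * phi - b%:~R by ring: g.
  move: (n%:~R - _) e lo hi => t e lo hi.
  by rewrite intrD; apply/andP; split; nra.
case: n lo hi hN fl => n lo hi hN fl.
  by exists n; rewrite hN (floor_def fl).
have : b%:~R < 0 :> R.
  have [+ _] := andP fl; have : (Negz n)%:~R <= (-1)%:~R :> R by rewrite ler_int; lia.
  by move: (_%:~R) => x; nra.
by rewrite ltrz0; lia.
Qed.

(** Multiplying the hypothesis by [phi ^ 2] turns it into [-1 < a - n phi < 0],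
    since [phi ^ 2 (2 - phi) = 1] and [phi ^ 2 (phi - 1) = phi]; hence
    [a = floor (n phi)].  Again [n <= 0] would make [N] negative. *)
Lemma beatty_rest_of_window (N : nat) (a n : int) :
  phi - 2 < (2 * a + n)%:~R - (a + n)%:~R * phi < 0 ->
  N%:Z = 3 * a + n + 1 -> beatty_rest N.
Proof.
have g1 := golden_mean_gt1; have g2 := golden_mean_lt2; have g := golden_mean_sqr.
move=> /andP[lo hi] hN.
have e : phi ^+ 2 * ((2 * a + n)%:~R - (a + n)%:~R * phi) = a%:~R - n%:~R * phi.
  by ring: g.
have e2 : phi ^+ 2 * (phi - 2) = -1 by ring: g.
have g3 : 0 < phi ^+ 2 by rewrite exprn_gt0 //; lra.
rewrite -(ltr_pM2l g3) e e2 in lo; rewrite -(ltr_pM2l g3) e mulr0 in hi.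
have lt_an : a%:~R < n%:~R * phi by lra.
have lt_na : n%:~R * phi < (a + 1)%:~R by rewrite intrD; lra.
have n_gt0 : 0 < n.
  rewrite ltNge; apply/negP => n_le0.
  have : a%:~R < 0 :> R. have : n%:~R <= 0 :> R by rewrite lerz0. nra.
  by rewrite ltrz0; lia.
case: n n_gt0 {e lo hi} lt_an lt_na hN => n // n_gt0 lt_an lt_na hN.
exists n; split; first by [].
by rewrite hN (@floor_def _ _ a) // (ltW lt_an).
Qed.

(** If [f] is the fractional part of [n phi], then
    [k phi = k + n - f (phi - 1)].  The case [f = 0] has to be excluded by
    irrationality, since it would raise the first floor by one. *)
Lemma floor_golden_mean_iter (n : nat) (k : int) :
  (0 < n)%N -> Num.floor (n%:R * phi) = k -> Num.floor (k%:~R * phi) = k + n%:Z - 1 /\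
  Num.floor ((k + 1)%:~R * phi) = k + n%:Z + 1.
Proof.
have g1 := golden_mean_gt1; have g2 := golden_mean_lt2; have g := golden_mean_sqr.
move=> n_gt0 kE; have := floor_itv (n%:R * phi).
rewrite kE intrD => /andP[lo hi].
have {}lo : k%:~R < n%:R * phi.
  rewrite lt_neqAle lo andbT; apply: contraTneq n_gt0 => hk.
  by have [->] := golden_mean_irrational n k (esym hk).
have e : k%:~R * phi = k%:~R + n%:R - (n%:R * phi - k%:~R) * (phi - 1).
  by ring: g.
move: (n%:R * phi) e lo hi => t e lo hi.
split; apply: floor_def; rewrite !(intrD, intrB); apply/andP; split; nra.
Qed.

(** By [floor_golden_mean_iter] the witness is [k = floor (n phi)]. *)
Lemma beatty_rest_gap N : beatty_rest N -> exists k : nat,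
  N%:Z = Num.floor (k%:R * phi) + 2 * k%:Z + 2 /\
  N%:Z = Num.floor (k.+1%:R * phi) + 2 * k.+1%:Z - 2.
Proof.
move=> [n [n_gt0 ->]]; have := floor_golden_mean_iter n _ n_gt0 erefl.
have : 0 <= Num.floor (n%:R * phi).
  by rewrite floor_ge0 mulr_ge0 ?ler0n //; have := golden_mean_gt1; lra.
case: (Num.floor _) => // k _ [h1 h2]; exists k.
have -> : k.+1%:R = (k%:Z + 1)%:~R :> R by rewrite intrD -natr1.
by rewrite h1 h2; split; lia.
Qed.

Lemma beatty_shift_inj (c c' : int) N : -1 <= c <= 1 -> -1 <= c' <= 1 ->
  beatty_shift c N -> beatty_shift c' N -> c = c'.
Proof.
move=> hc hc' [m hm] [n]; rewrite hm; have [mn|nm|->] := ltngtP m n; last by lia.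
- by have := beatty_step_ge3 _ _ mn; lia.
- by have := beatty_step_ge3 _ _ nm; lia.
Qed.

Lemma beatty_shift_rest (c : int) N : -1 <= c <= 1 ->
  beatty_shift c N -> ~ beatty_rest N.
Proof.
move=> hc [m hm] /beatty_rest_gap[k [hk hk1]]; have [km|mk] := ltnP k m.
- have : (k.+1 == m) || (k.+1 < m)%N by rewrite -leq_eqVlt.
  case/orP => [/eqP e|lt]; first by rewrite e in hk1; lia.
  by have := beatty_step_ge3 _ _ lt; lia.
- move: mk; rewrite leq_eqVlt => /orP[/eqP e|lt]; first by rewrite e in hm; lia.
  by have := beatty_step_ge3 _ _ lt; lia.
Qed.

(** * From digits to sequences, and back *)

Lemma int_eq_of_dist_lt1 (x y : int) : x%:~R - 1 < y%:~R :> R -> y%:~R < x%:~R + 1 :> R -> y = x.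
Proof.
move=> lo hi; have : x < y + 1 by rewrite -(ltr_int R) intrD; lra.
have : y < x + 1 by rewrite -(ltr_int R) intrD; lra.
by lia.
Qed.

(** With [A = a + b phi], the index [n] is [a - 1], [a + 1], [a] and [b - a] in the
    four cases: in the first three [b] is [floor (n phi)], and in the last one
    [a] is. *)
Lemma base_phi_classify N d : base_phi_representation R N d ->
  [/\ d 0 = 1%N -> beatty_shift 1 N,
     d 1 = 1%N /\ d 0 = 0%N -> beatty_shift (-1) N,
     [/\ d 1 = 0%N, d 0 = 0%N & d (-1) = 0%N] -> beatty_shift 0 N &
     [/\ d 1 = 0%N, d 0 = 0%N & d (-1) = 1%N] -> beatty_rest N].
Proof.
have g1 := golden_mean_gt1; have g2 := golden_mean_lt2; have g := golden_mean_sqr.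
move=> hd; have [K hN] := base_phi_split _ _ hd; case: hd => h01 hadj _ _.
have hpos : phi_digits (fun i => d (Posz i)).
  split=> i; first exact: h01.
  move=> di; case: (h01 i.+1) => // di1; case: (hadj i); split=> //.
  by rewrite -di1; congr d; lia.
have hneg : phi_digits (fun i => d (Negz i)).
  split=> i; first exact: h01.
  move=> di; case: (h01 (Negz i.+1)) => // di1; case: (hadj (Negz i.+1)).
  by split=> //; rewrite -di; congr d; lia.
have [a [b [hA hA']]] := digit_sum_conj (fun i => d (Posz i)) K.+2.
have w1 := digit_sum_conj_1 _ K.+1 hpos.
have w01 := digit_sum_conj_01 _ K hpos.
have w00 := digit_sum_conj_00 _ K hpos.
have [B01 B0 B1] := fractional_part_bound K.+1 _ hneg.
(* [w1], [w01] and [w00] now bound [a + b psi], and [B] is the tail. *)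
rewrite hA' /= in w1 w01 w00; rewrite hA in hN.
move: (phi^-1 * _) hN B01 B0 B1 => B hN /andP[Bge0 Blt1] B0 B1.
split.
- move=> d0; have /andP[lo hi] := w1 d0.
  have dm1 : d (-1) = 0%N.
    by case: (h01 (-1)) => // dm; case: (hadj (-1)); split.
  have {}Bhi := B0 dm1.
  have e : N%:Z = b + 2 * (a - 1) + 1.
    by apply: int_eq_of_dist_lt1; rewrite !(intrD, intrM, intrB) ; lra.
  apply: (beatty_shift_of_window _ (a - 1) b) => //.
  move/(congr1 (intr : int -> R)): e; rewrite !(intrD, intrM, intrB) => e.
  by apply/andP; split; lra.
- case=> d1 d0; have /andP[lo hi] := w01 d0 d1.
  have e : N%:Z = b + 2 * (a + 1) - 1.
    by apply: int_eq_of_dist_lt1; rewrite !(intrD, intrM, intrB) ; lra.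
  apply: (beatty_shift_of_window _ (a + 1) b) => //.
  move/(congr1 (intr : int -> R)): e; rewrite !(intrD, intrM, intrB) => e.
  by apply/andP; split; lra.
- case=> d1 d0 dm1; have /andP[lo hi] := w00 d0 d1; have {}Bhi := B0 dm1.
  have e : N%:Z = b + 2 * a + 0.
    by apply: int_eq_of_dist_lt1; rewrite !(intrD, intrM, intrB) ; lra.
  apply: (beatty_shift_of_window _ a b) => //.
  move/(congr1 (intr : int -> R)): e; rewrite !(intrD, intrM, intrB) => e.
  by apply/andP; split; lra.
- case=> d1 d0 dm1; have /andP[lo hi] := w00 d0 d1; have {}Blo := B1 dm1.
  have e : N%:Z = 2 * a + b + 1.
    by apply: int_eq_of_dist_lt1; rewrite !(intrD, intrM, intrB) ; lra.
  apply: (beatty_rest_of_window _ a (b - a)); last by rewrite e; lia.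
  move/(congr1 (intr : int -> R)): e; rewrite !(intrD, intrM, intrB) => e.
  by apply/andP; split; lra.
Qed.

End GoldenMean.

Theorem theorem5p1 (R : realType) (N : nat) (d : int -> nat)
    (hd : base_phi_representation R N d) :
  [/\ d 0 = 1%N <->
        exists n : nat,
          N%:Z = Num.floor (n%:R * golden_mean R) + 2 * n%:Z + 1,
      (d 1 = 1%N /\ d 0 = 0%N) <->
        exists n : nat,
          N%:Z = Num.floor (n%:R * golden_mean R) + 2 * n%:Z - 1,
      [/\ d 1 = 0%N, d 0 = 0%N & d (-1) = 0%N] <->
        exists n : nat,
          N%:Z = Num.floor (n%:R * golden_mean R) + 2 * n%:Z &
      [/\ d 1 = 0%N, d 0 = 0%N & d (-1) = 1%N] <->
        exists n : nat, (0 < n)%N /\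
          N%:Z = 3 * Num.floor (n%:R * golden_mean R) + n%:Z + 1].
Proof.
have [f1 f10 f000 f001] := base_phi_classify _ _ _ hd.
have e0 : (exists n : nat, N%:Z = Num.floor (n%:R * golden_mean R) + 2 * n%:Z)
    <-> beatty_shift R 0 N.
  by split=> -[n hn]; exists n; rewrite hn addr0.
rewrite -[exists n : nat, N%:Z = _ + 1]/(beatty_shift R 1 N).
rewrite -[exists n : nat, N%:Z = _ - 1]/(beatty_shift R (-1) N).
rewrite -[exists n : nat, _ /\ _]/(beatty_rest R N).
have inj := @beatty_shift_inj R _ _ N; have rest := @beatty_shift_rest R _ N.
have [h01 _ _ _] := hd.
have cases : [\/ d 0 = 1%N, d 1 = 1%N /\ d 0 = 0%N,
    [/\ d 1 = 0%N, d 0 = 0%N & d (-1) = 0%N] |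
    [/\ d 1 = 0%N, d 0 = 0%N & d (-1) = 1%N]].
  case: (h01 0) => [h0|]; last by constructor 1.
  case: (h01 1) => [h1|]; last by constructor 2.
  by case: (h01 (-1)) => h; [constructor 3|constructor 4].
split.
- split=> // h; case: cases => [//|/f10 h'|/f000 h'|/f001 h'].
  + by have := inj 1 (-1) isT isT h h'.
  + by have := inj 1 0 isT isT h h'.
  + by case: (rest 1 isT h).
- split=> // h; case: cases => [/f1 h'|//|/f000 h'|/f001 h'].
  + by have := inj (-1) 1 isT isT h h'.
  + by have := inj (-1) 0 isT isT h h'.
  + by case: (rest (-1) isT h).
- rewrite e0; split=> // h; case: cases => [/f1 h'|/f10 h'|//|/f001 h'].
  + by have := inj 0 1 isT isT h h'.
  + by have := inj 0 (-1) isT isT h h'.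
  + by case: (rest 0 isT h).
- split=> // h; case: cases => [/f1 h'|/f10 h'|/f000 h'|//].
  + by case: (rest 1 isT h').
  + by case: (rest (-1) isT h').
  + by case: (rest 0 isT h').
Qed.
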